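(* Let $A$ be the Clifford algebra with basis $(i_p)_{p\in G}$, where $G$ is the group of non-negative integers under bitwise exclusive or $\oplus$. There is a function (a twist) $\phi: G\times G\to\{-1,1\}$ such that for all $p,q\in G$, $$i_p\, i_q=\phi(p,q)\, i_{p\oplus q}.$$
   Context: Let $R$ be a commutative ring with $1$ (usually $\mathbb{R}$) and fix $\mu\in\{1,-1\}$. The Clifford algebra $A$ is an associative unital $R$-algebra containing elements $e_1,e_2,e_3,\dots$ (an infinite sequence) with $e_k^2=\mu\cdot 1$ for all $k\ge 1$ and $e_je_k=-e_ke_j$ for all $j\neq k$, such that the elements $i_p$ defined next form a basis of $A$ over $R$. For a non-negative integer $p$ with binary expansion $p=\sum_{j=1}^m 2^{k_j-1}$, $1\le k_1<k_2<\dots<k_m$, put $i_p=e_{k_1}e_{k_2}\cdots e_{k_m}$; in particular $i_0=1$ and $i_{2^{k-1}}=e_k$. $G$ denotes the set of all non-negative integers, which is a group under bitwise exclusive or (XOR), written $p\oplus q$. *)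

(* Defs.v *)
From Stdlib Require PeanoNat.
From mathcomp Require Import all_boot all_order all_algebra.

Set Implicit Arguments.
Unset Strict Implicit.
Unset Printing Implicit Defensive.

Import GRing.Theory.
Local Open Scope ring_scope.

(* The group operation of G: nat under bitwise exclusive or. *)
Notation "p ⊕ q" := (Nat.lxor p q) (at level 50, left associativity) : nat_scope.

(* The generators are indexed from 1, so the value [e 0] is never used.
   Bit [k.-1] of [p] selects [e k]; the product is taken in increasing order
   of [k], and no bit is lost since [2 ^ k.-1 <= p] forces [k <= p]. *)
Definition blade (A : pzRingType) (e : nat -> A) (p : nat) : A :=
  \prod_(1 <= k < p.+1 | Nat.testbit p k.-1) e k.

Definition is_basis (R : pzRingType) (V : lmodType R) (b : nat -> V) : Prop :=
  (forall v : V, exists (n : nat) (c : nat -> R), v = \sum_(p < n) c p *: b p) /\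
  (forall (n : nat) (c : nat -> R), \sum_(p < n) c p *: b p = 0 ->
     forall p, (p < n)%N -> c p = 0).

Record clifford_algebra (R : comNzRingType) (mu : R) (A : algType R)
    (e : nat -> A) : Prop := CliffordAlgebra {
  gen_sqr : forall k, (0 < k)%N -> e k ^+ 2 = mu%:A;
  gen_anticomm : forall j k, (0 < j)%N -> (0 < k)%N -> j != k ->
    e j * e k = - (e k * e j);
  blade_basis : is_basis (blade e)
}.

Lemma testbit_sum_pow2 (s : seq nat) (j : nat) :
  uniq s -> Nat.testbit (\sum_(k <- s) 2 ^ k)%N j = (j \in s).
Proof.
have powE k : (2 ^ k)%N = Nat.pow 2 k by elim: k => //= k IHk; rewrite expnS IHk.
elim: s j => [|a s IHs] j /=; first by rewrite big_nil PeanoNat.Nat.bits_0.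
case/andP=> a_s uniq_s; rewrite big_cons powE -plusE.
have bit2 i : Nat.testbit (Nat.pow 2 a) i = (i == a).
  by rewrite PeanoNat.Nat.pow2_bits_eqb; apply/PeanoNat.Nat.eqb_spec/eqP.
rewrite PeanoNat.Nat.add_nocarry_lxor.
  rewrite PeanoNat.Nat.lxor_spec bit2 IHs // inE.
  by case: eqP => // ->; rewrite (negPf a_s).
apply: PeanoNat.Nat.bits_inj_0 => i.
rewrite PeanoNat.Nat.land_spec bit2 IHs //.
by case: eqP => // ->; rewrite (negPf a_s).
Qed.

(* If [p] is the sum of the [2 ^ (k_j - 1)] with [1 <= k_1 < ... < k_m],
   then [blade e p] is [e k_1 * ... * e k_m]. *)
Lemma blade_binary (A : pzRingType) (e : nat -> A) (s : seq nat) :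
  sorted ltn s -> all (ltn 0) s ->
  blade e (\sum_(k <- s) 2 ^ k.-1)%N = \prod_(k <- s) e k.
Proof.
move=> sorted_s /allP s_gt0; set p := (\sum_(k <- s) _)%N.
have uniq_s : uniq s by apply: sorted_uniq sorted_s; [exact: ltn_trans|exact: ltnn].
have bitp j : Nat.testbit p j = (j \in map predn s).
  rewrite -testbit_sum_pow2 ?big_map // map_inj_in_uniq // => x y.
  by move=> /s_gt0 + /s_gt0; case: x y => [|x] [|y] //= _ _ ->.
rewrite /blade -big_filter; congr (\big[_/_]_(k <- _) _).
apply: (irr_sorted_eq ltn_trans ltnn) => //.
  exact: sorted_filter ltn_trans _ _ (iota_ltn_sorted _ _).
move=> k; rewrite mem_filter mem_index_iota bitp.
apply/andP/idP => [[/mapP[l ls]]|ks].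
  by have := s_gt0 l ls; case: l ls k => [|l] // ls [|k] //= _ ->.
rewrite map_f //; split=> //.
have -> : (0 < k)%N by apply: s_gt0.
rewrite ltnS /p (bigD1_seq k) //=; apply: leq_trans (leq_addr _ _).
by have := s_gt0 k ks; case: (k) => //= n _; apply: ltn_expl.
Qed.

(* Main.v *)
Require Import Defs.
From mathcomp Require Import all_boot all_order all_algebra.
From Stdlib Require PeanoNat.

Import GRing.Theory.
Local Open Scope ring_scope.

(** Multiplying [i_p] by [i_q] only requires moving generators past each other
    and cancelling squares; each such step changes the product by a factor
    [1] or [-1], and the generators that survive are those occurring in exactly
    one of the factors.  Equality in [A] is decidable, so the sign can be read
    off the two sides. *)

(** Each selected factor that [x] passes costs one sign, so [s] is the parity of the number of
    selected indices. *)
Lemma anticomm_prod_comm (A : pzRingType) (e : nat -> A) (P : pred nat) n x :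
  (forall j, (0 < j <= n)%N -> x * e j = - (e j * x)) ->
  exists s : bool, x * \prod_(1 <= k < n.+1 | P k) e k =
                   (-1) ^+ s * (\prod_(1 <= k < n.+1 | P k) e k * x).
Proof.
elim: n => [|n IHn] xe; first by exists false; rewrite big_geq // mulr1 !mul1r.
have [|s xprod] := IHn.
  by move=> j /andP[j_gt0 le_jn]; apply: xe; rewrite j_gt0 leqW.
rewrite big_mkcond big_nat_recr //= -big_mkcond /=.
exists (s (+) P n.+1); rewrite mulrA xprod signr_addb -!mulrA.
case: (P n.+1); last by rewrite mulr1 mul1r expr0 mul1r.
by rewrite xe ?ltnS ?leqnn // expr1 mulN1r !mulrN.
Qed.

(** Induction on the common bound [n]: the top generator is peeled off both products at once. *)
Lemma anticomm_prod_mul (A : pzRingType) (e : nat -> A) (P Q : pred nat) n :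
  (forall k, (0 < k)%N -> e k ^+ 2 = 1 \/ e k ^+ 2 = -1) ->
  (forall j k, (0 < j)%N -> (0 < k)%N -> j != k -> e j * e k = - (e k * e j)) ->
  exists s : bool,
    \prod_(1 <= k < n.+1 | P k) e k * \prod_(1 <= k < n.+1 | Q k) e k =
    (-1) ^+ s * \prod_(1 <= k < n.+1 | P k (+) Q k) e k.
Proof.
move=> e_sqr e_anti; elim: n => [|n [s prodPQ]].
  by exists false; rewrite !big_geq // !mul1r.
have recr (S : pred nat) : \prod_(1 <= k < n.+2 | S k) e k =
    \prod_(1 <= k < n.+1 | S k) e k * (if S n.+1 then e n.+1 else 1).
  by rewrite big_mkcond big_nat_recr //= -big_mkcond.
have [|t eQ] := @anticomm_prod_comm A e Q n (e n.+1).
  move=> j /andP[j_gt0 le_jn]; apply: e_anti => //.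
  by rewrite gtn_eqF.
have [u ee] : exists u : bool, e n.+1 ^+ 2 = (-1) ^+ u.
  by case: (e_sqr n.+1 isT) => ->; [exists false | exists true].
(* The sign [t] of moving [e n.+1] past the lower [Q]-product enters when [P n.+1] holds; the sign
   [u] of its square enters when [Q n.+1] holds as well. *)
rewrite !recr; case: (P n.+1); case: (Q n.+1) => /=.
- exists (t (+) u (+) s).
  rewrite -mulrA (mulrA (e _)) eQ -!mulrA -expr2 ee.
  rewrite commr_sign (mulrA ((-1) ^+ t)) -signr_addb.
  by rewrite mulrA commr_sign -mulrA prodPQ mulrA -signr_addb mulr1.
- exists (t (+) s).
  rewrite mulr1 -mulrA eQ mulrA commr_sign -mulrA.
  by rewrite (mulrA _ _ (e _)) prodPQ !mulrA -signr_addb.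
- by exists s; rewrite mulr1 mulrA prodPQ mulrA.
- by exists s; rewrite !mulr1.
Qed.

Lemma testbit_small p k : (p <= k)%N -> Nat.testbit p k = false.
Proof.
(* Zero is treated apart: [log2 0 = 0] is not below [k] when [k = 0]. *)
case: p => [|p] ltpk; first exact: PeanoNat.Nat.bits_0.
apply: PeanoNat.Nat.bits_above_log2.
apply: (PeanoNat.Nat.lt_le_trans _ p.+1); last exact/leP.
by apply: PeanoNat.Nat.log2_lt_lin; apply/ltP.
Qed.

(** This puts the blades of [p], [q] and [p ⊕ q] over one index range, as [anticomm_prod_mul]
    requires. *)
Lemma blade_widen (A : pzRingType) (e : nat -> A) (p n : nat) : (p <= n)%N ->
  blade e p = \prod_(1 <= k < n.+1 | Nat.testbit p k.-1) e k.
Proof.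
move=> le_pn; rewrite /blade (@big_cat_nat _ _ _ p.+1 1 n.+1) //=.
rewrite [X in _ * X]big1_seq ?mulr1 // => k.
rewrite mem_index_iota => /andP[+ /andP[lt_pk _]].
by rewrite testbit_small //; case: k lt_pk.
Qed.

Theorem theorem2p5 (R : comNzRingType) (mu : R) (A : algType R) (e : nat -> A)
    (hmu : mu = 1 \/ mu = -1) (hA : clifford_algebra mu e) :
  exists phi : nat -> nat -> int,
    (forall p q : nat, phi p q = 1 \/ phi p q = -1) /\
    (forall p q : nat,
       blade e p * blade e q = (phi p q)%:~R *: blade e (p ⊕ q)%N).
Proof.
exists (fun p q =>
  if blade e p * blade e q == blade e (p ⊕ q)%N then 1 else -1).
split=> p q; first by case: eqP; [left | right].
have [e_sqr e_anti _] := hA.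
have e_sqr1 k : (0 < k)%N -> e k ^+ 2 = 1 \/ e k ^+ 2 = -1.
  by move/e_sqr->; case: hmu => ->; rewrite ?scaleN1r ?scale1r; [left | right].
case: eqP => [-> | neq]; first by rewrite scale1r.
rewrite mulrN1z scaleN1r.
(* [p ⊕ q] may exceed both [p] and [q], as in [1 ⊕ 2 = 3], so it enters the bound. *)
pose n := maxn (p ⊕ q)%N (maxn p q).
have [s] := @anticomm_prod_mul A e (fun k => Nat.testbit p k.-1)
  (fun k => Nat.testbit q k.-1) n e_sqr1 e_anti.
under [X in _ = _ * X]eq_bigl => k.
  rewrite (_ : _ (+) _ = Nat.testbit (p ⊕ q)%N k.-1); first over.
  by rewrite PeanoNat.Nat.lxor_spec; case: Nat.testbit; case: Nat.testbit.
rewrite -!blade_widen ?leq_max ?leqnn ?orbT //.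
(* A positive sign would contradict [neq], so the sign is [-1]. *)
by case: s => [->|]; [rewrite mulN1r | rewrite mul1r => /neq].
Qed.
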